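(* Let $F_i(L)$ and $\alpha_i(a)$ be sequences, depending on $L$ and $a$ respectively, for $i=-1,0,1$. If \begin{align*} F_0(L) &= \sum_{a=-\infty}^\infty \alpha_0(a) T_0\left(\begin{array}{c}L\\ a \end{array};q \right), \qquad F_1(L) = \sum_{a=-\infty}^\infty \alpha_1(a) T_1\left(\begin{array}{c}L\\ a \end{array};q \right), \\ F_{-1}(L) &= \sum_{a=-\infty}^\infty \alpha_{-1}(a) \left\{T_{-1}\left(\begin{array}{c}L\\ a \end{array};q \right)+T_{-1}\left(\begin{array}{c}L\\ a+1 \end{array};q \right)\right\}, \end{align*} then \begin{align*} \sum_{i\geq 0} q^{\frac{i^2}{2}} {L \brack i}_q F_0(i) &= \sum_{a=-\infty}^\infty \alpha_0(a) q^{\frac{a^2}{2}} {2L\brack L-a}_q,\\ (1+q^L)\sum_{i\geq 0} q^{\binom{i}{2}} {L \brack i}_q F_1(i) &= \sum_{a=-\infty}^\infty \alpha_1(a)(1+q^a) q^{\binom{a}{2}} {2L\brack L-a}_q,\\ \sum_{i\geq 0} q^{\binom{i+1}{2}} {L \brack i}_q F_{-1}(i) &= \sum_{a=-\infty}^\infty \alpha_{-1}(a) q^{\binom{a+1}{2}} {2L+1 \brack L-a}_q. \end{align*}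
   Context: Notation: $(a;q)_n=(1-a)(1-aq)\cdots(1-aq^{n-1})$ with $1/(q;q)_n=0$ for $n<0$. The $q$-binomial coefficient is ${m+n\brack m}_q=\frac{(q;q)_{m+n}}{(q;q)_m(q;q)_n}$ for $m,n\geq 0$ and $0$ otherwise. The $q$-trinomial coefficient is $\left(\begin{array}{c}L,\, b\\ a \end{array};q\right)_2 = \sum_{n\geq 0} q^{n(n+b)} \frac{(q;q)_L}{(q;q)_n(q;q)_{n+a}(q;q)_{L-2n-a}}$, and for an integer $n$, $T_n\left(\begin{array}{c}L\\ a\end{array};q\right) = q^{(L(L-n)-a(a-n))/2}\left(\begin{array}{c}L,\, a-n\\ a \end{array};1/q\right)_2$. *)

(* Defs.v *)
From mathcomp Require Import all_boot all_order all_algebra.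
From mathcomp Require Import classical_sets fsbigop.
Set Implicit Arguments.
Unset Strict Implicit.
Unset Printing Implicit Defensive.
Import Order.TTheory GRing.Theory Num.Theory.
Local Open Scope ring_scope.

(* The series over a : int, n : nat and i : nat are written with the finitely
   supported sum \sum_(x \in setT) of fsbigop, which is the sum of the nonzero
   terms when there are finitely many of them.  All the series below have
   finite support, because the coefficients involved vanish outside a bounded
   range of the index.  Definitions dividing by (q;q)_n are meaningful when q
   is not a root of unity. *)

Section QSeries.
Variable K : fieldType.
Implicit Types (q s : K) (n L : nat) (a b k m : int).

Definition qpoch (x q : K) n : K := \prod_(k < n) (1 - x * q ^+ k).

(* The value 0 for m < 0 is the usual convention for 1 / (q;q)_m. *)
Definition inv_qpoch q m : K :=
  match m with
  | Posz n => (qpoch q q n)^-1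
  | Negz _ => 0
  end.

(* [N over k]_q : the case m = k, n = N - k of (q;q)_(m+n) / ((q;q)_m (q;q)_n),
   which is 0 unless m and n are both nonnegative. *)
Definition qbinom q (N k : int) : K :=
  if (0 <= k) && (0 <= N - k)
  then qpoch q q `|N|%N / (qpoch q q `|k|%N * qpoch q q `|N - k|%N)
  else 0.

Definition qtrinom q L b a : K :=
  \sum_(n \in [set: nat])
     q ^ (n%:Z * (n%:Z + b)) *
     (qpoch q q L * inv_qpoch q n%:Z * inv_qpoch q (n%:Z + a)
                  * inv_qpoch q (L%:Z - 2 * n%:Z - a)).

(* T_m(L; a; q) at q = s ^+ 2.  The exponent of q in the prefactor may be a
   half-integer, so it is expressed through the chosen square root s of q:
   q^(e/2) is s ^ e. *)
Definition qtrinomT s m L a : K :=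
  s ^ (L%:Z * (L%:Z - m) - a * (a - m)) * qtrinom (s ^+ 2)^-1 L (a - m) a.

End QSeries.

(* binom(a, 2) for an integer a; the division is exact. *)
Definition binz2 (a : int) : int := ((a * (a - 1)) %/ 2)%Z.

(* Main.v *)
(* Inverting the base in the trinomial coefficient gives, with k = L - 2n - a,
     T_m(L; a) = \sum_n q^(k(k-m)/2) (q;q)_L / ((q;q)_n (q;q)_(n+a) (q;q)_k),
   so each identity reduces to its coefficient of alpha(a), a double sum over
   n and i.  With r = i - n - a, the exponent (i(i-m) + k(k-m))/2 equals
     a(a-m)/2 + r(r+a-m) + n(n+a),
   the sum over n is a q-Vandermonde sum for [L; r+a], and what remains is
     q^(a(a-m)/2) \sum_r q^(r(r+a-m)) [L; r] [L; r+a].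
   This is again q-Vandermonde for m = 0, and for m = 1, -1 after Pascal's
   rule. *)
Require Import Defs.
From mathcomp Require Import all_boot all_order all_algebra.
From mathcomp Require Import classical_sets fsbigop.
From mathcomp Require Import zify ring.
Import Order.TTheory GRing.Theory Num.Theory.
Local Open Scope ring_scope.

(** * Gaussian binomials: Pascal's rules and q-Vandermonde sums *)

Section QBinomial.
Set Implicit Arguments.
Unset Strict Implicit.
Variables (K : fieldType) (q : K).
Implicit Types (a k c : int) (A B L M N n r : nat).

Lemma qpochS n : qpoch q q n.+1 = qpoch q q n * (1 - q ^+ n.+1).
Proof. by rewrite /qpoch big_ord_recr /= exprS. Qed.

Lemma inv_qpoch_neg k : k < 0 -> inv_qpoch q k = 0.
Proof. by case: k. Qed.

(** The zero convention of [inv_qpoch] absorbs the range test, so that Pascal's rules need no case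
    analysis on [k]. *)
Lemma qbinomE N k :
  qbinom q N k = qpoch q q N * inv_qpoch q k * inv_qpoch q (N%:Z - k).
Proof.
rewrite /qbinom; case: k => k; last by rewrite /= mulr0 mul0r.
case: ifPn => [|kN]; last by rewrite [inv_qpoch q (_ - _)]inv_qpoch_neg ?mulr0 //; lia.
case: (N%:Z - k%:Z) => [m _|m]; last by rewrite andbF.
by rewrite /= invfM mulrA.
Qed.

Lemma qbinom_out N k : (k < 0) || (N%:Z < k) -> qbinom q N k = 0.
Proof. by rewrite /qbinom subr_ge0 !leNgt -negb_or => ->. Qed.

Lemma qbinom_sym N k : qbinom q N (N%:Z - k) = qbinom q N k.
Proof. by rewrite !qbinomE subKr mulrAC. Qed.

Lemma qbinom0 k : qbinom q 0 k = (k == 0)%:R.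
Proof.
rewrite /qbinom sub0r oppr_ge0; case: k => [[|n]|n] //=.
by rewrite /qpoch !big_ord0 mulr1 divr1.
Qed.

Hypothesis hq0 : q != 0.
Hypothesis hq : forall n : nat, (0 < n)%N -> q ^+ n != 1.

Lemma qpoch_neq0 n : qpoch q q n != 0.
Proof.
by apply/prodf_neq0 => i _; rewrite -exprS subr_eq0 eq_sym; apply: hq.
Qed.

(** At k = 0 both sides vanish because 1 - q^0 = 0, so the recurrence crosses the boundary of the
    zero convention. *)
Lemma inv_qpoch_pred k : inv_qpoch q (k - 1) = (1 - q ^ k) * inv_qpoch q k.
Proof.
case: k => [[|n]|n]; first by rewrite expr0z subrr mul0r.
- have -> : n.+1%:Z - 1 = n%:Z by lia.
  rewrite /= qpochS -exprnP invfM mulrCA divff ?mulr1 //.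
  by rewrite subr_eq0 eq_sym hq.
- by rewrite mulr0 inv_qpoch_neg //; lia.
Qed.

Lemma qbinomS N k :
  qbinom q N.+1 k = qbinom q N (k - 1) + q ^ k * qbinom q N k.
Proof.
rewrite !qbinomE inv_qpoch_pred.
have -> : N%:Z - (k - 1) = N.+1%:Z - k by lia.
have -> : N%:Z - k = N.+1%:Z - k - 1 by lia.
rewrite inv_qpoch_pred qpochS expfzDr // -exprnP -invr_expz.
have: q ^ k != 0 by apply: expfz_neq0.
by move=> h; field.
Qed.

Lemma qbinomS_sym N k :
  qbinom q N.+1 k = q ^ (N.+1%:Z - k) * qbinom q N (k - 1) + qbinom q N k.
Proof.
rewrite -qbinom_sym qbinomS addrC; congr (_ * _ + _).
  by rewrite -qbinom_sym; congr (qbinom _ _ _); lia.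
by rewrite -qbinom_sym; congr (qbinom _ _ _); lia.
Qed.

(** Induction on [B] with [c] free, since Pascal's rule also calls for c - 1. Any [M] above [A]
    gives the same sum, as [A; n] = 0 for n > A. *)
Lemma q_Vandermonde A B c M : (A < M)%N ->
  \sum_(n < M) q ^ (n%:Z * (n%:Z + c)) * qbinom q A n * qbinom q B (n%:Z + c)
  = qbinom q (A + B)%N (A%:Z + c).
Proof.
move=> AM; elim: B c => [|B IHB] c.
  rewrite addn0 -qbinom_sym.
  have -> : A%:Z - (A%:Z + c) = - c by lia.
  have vanish (i : 'I_M) : i%:Z != - c ->
      q ^ (i%:Z * (i%:Z + c)) * qbinom q A i * qbinom q 0 (i%:Z + c) = 0.
    by rewrite qbinom0 addr_eq0 => /negPf ->; rewrite mulr0.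
  (* Only n = -c can contribute. If -c lies outside [0, M), both sides vanish, the right one because
     A < M. *)
  case: (boolP ((0 <= - c) && (- c < M%:Z))) => [/andP[c0 cM]|cN]; last first.
    rewrite big1 => [|i _]; last by apply: vanish; move: (ltn_ord i); lia.
    by rewrite qbinom_out //; lia.
  have hM : (`|c| < M)%N by lia.
  rewrite (bigD1 (Ordinal hM)) //= big1 => [|i iN]; last first.
    by apply: vanish; apply: contraNneq iN => h; rewrite -val_eqE /=; lia.
  have -> : `|c|%N%:Z = - c by lia.
  by rewrite addNr mulr0 expr0z qbinom0 eqxx mulr1 mul1r addr0.
(* Pascal's rule for [B+1; n+c] brings in q^(B+1-c-n), whose part q^(-n) turns q^(n(n+c)) into
   q^(n(n+c-1)). *)
transitivity (qbinom q (A + B)%N (A%:Z + c)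
    + q ^ (B.+1%:Z - c) * qbinom q (A + B)%N (A%:Z + (c - 1))).
  rewrite -!IHB mulr_sumr -big_split /=; apply: eq_bigr => i _.
  rewrite qbinomS_sym mulrDr addrC; congr (_ + _).
  rewrite addrA !mulrA; congr (_ * _); rewrite mulrAC -!expfzDr //.
  by congr (q ^ _ * _); ring.
rewrite addnS qbinomS_sym addrC; congr (q ^ _ * qbinom _ _ _ + _); lia.
Qed.

Lemma sum_q_Vandermonde_central L a :
  \sum_(r < L.+1) q ^ (r%:Z * (r%:Z + a)) * qbinom q L r * qbinom q L (r%:Z + a)
  = qbinom q (2 * L%:Z) (L%:Z - a).
Proof.
rewrite q_Vandermonde // -qbinom_sym addnn -mul2n PoszM; congr (qbinom _ _ _).
by ring.
Qed.

(* Splitting [L; r] by Pascal's rule turns the sum into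
   [2L-1; L+a-1] + q^a [2L-1; L+a]. *)
Lemma sum_q_Vandermonde_pred L a :
  (1 + q ^+ L) * \sum_(r < L.+1) q ^ (r%:Z * (r%:Z + a - 1)) * qbinom q L r
                    * qbinom q L (r%:Z + a)
  = (1 + q ^ a) * qbinom q (2 * L%:Z) (L%:Z - a).
Proof.
case: L => [|L].
  (* With L = 0 there is no Pascal step; both sides are 1 + 1 if a = 0 and 0 otherwise. *)
  rewrite big_ord1 mul0r mulr0 !expr0z sub0r add0r !qbinom0 oppr_eq0 eqxx.
  by case: eqP => [->|_]; rewrite ?mulr0 ?expr0z // !mulr1.
have -> : \sum_(r < L.+2) q ^ (r%:Z * (r%:Z + a - 1)) * qbinom q L.+1 r
                    * qbinom q L.+1 (r%:Z + a)
  = qbinom q (L + L.+1)%N (L%:Z + a) + q ^ a * qbinom q (L + L.+1)%N (L%:Z + (a + 1)).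
  under eq_bigr do rewrite qbinomS // mulrDr mulrDl addrC.
  rewrite big_split /=; congr (_ + _).
    rewrite -(@q_Vandermonde _ _ _ L.+2) //; apply: eq_bigr => r _.
    rewrite mulrA -expfzDr //.
    by congr (q ^ _ * _ * _); ring.
  rewrite big_ord_recl [qbinom q L _]qbinom_out // mulr0 mul0r add0r.
  rewrite -(@q_Vandermonde _ _ _ L.+1) // mulr_sumr.
  apply: eq_bigr => r _; rewrite lift0 !mulrA -expfzDr //.
  congr (q ^ _ * qbinom _ _ _ * qbinom _ _ _); lia.
have -> : 2 * L.+1%:Z = (L + L.+1).+1%:Z by lia.
have e1 := qbinomS (L + L.+1) (L%:Z + a + 1).
have e2 := qbinomS_sym (L + L.+1) (L%:Z + a + 1).
have -> : qbinom q (L + L.+1).+1 (L.+1%:Z - a)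
    = qbinom q (L + L.+1).+1 (L%:Z + a + 1).
  by rewrite -qbinom_sym; congr (qbinom _ _ _); lia.
(* In X + q^a X the two copies of X are expanded by different Pascal rules; only then does the
   factor 1 + q^(L+1) split off. *)
rewrite [RHS]mulrDl mul1r {1}e1 e2 !addrK !addrA.
rewrite (_ : (L + L.+1).+1%:Z - (L%:Z + a + 1) = L.+1%:Z - a); last by lia.
rewrite (_ : L%:Z + a + 1 = L.+1%:Z + a); last by lia.
rewrite !expfzDr // -invr_expz -exprnP.
have : q ^ a != 0 by apply: expfz_neq0.
by move: (q ^ a) (qbinom _ _ _) (qbinom _ _ _) => u v v' hu; field.
Qed.

(** Pascal's rule for [L+1; r+a+1] splits the Vandermonde sum for L + (L+1) into these two sums, one
    for each of the neighbours a and a + 1. *)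
Lemma sum_q_Vandermonde_succ L a :
  \sum_(r < L.+1) q ^ (r%:Z * (r%:Z + a + 1)) * qbinom q L r * qbinom q L (r%:Z + a)
  + q ^ (a + 1) * \sum_(r < L.+1) q ^ (r%:Z * (r%:Z + (a + 1) + 1))
                    * qbinom q L r * qbinom q L (r%:Z + (a + 1))
  = qbinom q (2 * L%:Z + 1) (L%:Z - a).
Proof.
have -> : 2 * L%:Z + 1 = (L + L.+1)%N%:Z by lia.
rewrite -qbinom_sym (_ : _ - _ = L%:Z + (a + 1)); last by lia.
rewrite -(@q_Vandermonde _ _ _ L.+1) // mulr_sumr -big_split /=.
apply: eq_bigr => r _; rewrite qbinomS // [RHS]mulrDr !addrA addrK; congr (_ + _).
rewrite !mulrA -expfzDr // [_ * q ^ _]mulrAC -expfzDr //.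
by congr (q ^ _ * _ * _); ring.
Qed.

End QBinomial.

(** * Finite supports, reindexing and exchange of sums *)

Section FiniteSums.
Set Implicit Arguments.
Unset Strict Implicit.
Variable K : fieldType.
Implicit Types (a : int) (i n L M : nat).

Lemma fsbig_seqT (I : choiceType) (x : seq I) (f : I -> K) :
  uniq x -> (forall y, y \notin x -> f y = 0) ->
  \sum_(y \in [set: I]) f y = \sum_(y <- x) f y.
Proof.
move=> ux fx; rewrite (fsbigE x) // => [|y _]; last exact: fx.
by apply: eq_bigl => y; rewrite in_setT.
Qed.

Lemma fsbig_ordT (f : nat -> K) M :
  (forall n, (M <= n)%N -> f n = 0) ->
  \sum_(n \in [set: nat]) f n = \sum_(n < M) f n.
Proof.
move=> fM; rewrite (@fsbig_seqT _ (index_iota 0 M)) ?iota_uniq ?big_mkord //.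
by move=> n; rewrite mem_index_iota /= -leqNgt; apply: fM.
Qed.

(** Both windows contain the support of [f]. Each side is inflated to a double sum over pairs linked
    by the shift, and exchanging the sums identifies the two. *)
Lemma sum_ord_shift (f : int -> K) (c : int) M :
  (forall x, f x != 0 -> (0 <= x < M%:Z) && (0 <= x - c < M%:Z)) ->
  \sum_(i < M) f i%:Z = \sum_(i < M) f (i%:Z + c).
Proof.
move=> fM.
have expand (g : int -> K) (d : int) :
    (forall x, g x != 0 -> (0 <= x < M%:Z) && (0 <= x + d < M%:Z)) ->
    \sum_(i < M) g i = \sum_(i < M) \sum_(j < M) g i *+ (j%:Z == i%:Z + d).
  move=> gM; apply: eq_bigr => -[i /= iM] _.
  have [-> | /gM /andP[_ h]] := eqVneq (g i) 0.
    by rewrite big1 // => j _; rewrite mul0rn.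
  have hj : (`|(i%:Z + d)%R| < M)%N by lia.
  rewrite (bigD1 (Ordinal hj)) //= big1 => [|j jN]; last first.
    by case: eqP => // h'; case/eqP: jN; apply: val_inj => /=; lia.
  by rewrite addr0 gez0_abs ?eqxx //; lia.
rewrite (expand _ (- c)) ?(expand (fun x => f (x + c)) c) //.
- rewrite exchange_big; apply: eq_bigr => i _; apply: eq_bigr => j _.
  rewrite (_ : (i%:Z == j%:Z - c) = (j%:Z == i%:Z + c)); last by lia.
  by case: eqP => // ->.
- by move=> x /fM; lia.
Qed.

(* The window |a| <= i + 1, rather than i, leaves room for T_(-1)(i; a + 1). *)
Lemma fsbig_transform (q c : K) (w : nat -> K) (T : nat -> int -> K)
    (alpha : int -> K) (F : nat -> K) L :
  (forall i a, (i.+1%:Z < a) || (a < - i.+1%:Z) -> T i a = 0) ->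
  (forall i, F i = \sum_(a \in [set: int]) alpha a * T i a) ->
  c * (\sum_(i \in [set: nat]) w i * qbinom q L i * F i)
  = \sum_(a \in [set: int])
      alpha a * (c * \sum_(i < L.+1) w i * qbinom q L i * T i a).
Proof.
move=> T0 hF.
(* The 2L + 3 integers from -(L+1) to L+1: one list that serves every i <= L. *)
pose x : seq int := [seq j%:Z - L.+1%:Z | j <- iota 0 (2 * L + 3)].
have ux : uniq x by rewrite map_inj_uniq ?iota_uniq // => j k /addIr[].
have inx a : a \notin x -> (L.+1%:Z < a) || (a < - L.+1%:Z).
  apply: contraR => aL; apply/mapP; exists `|(a + L.+1%:Z)%R|%N; last by lia.
  by rewrite mem_iota; lia.
have T0x i a : (i <= L)%N -> a \notin x -> T i a = 0.
  by move=> iL /inx ax; apply: T0; lia.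
rewrite (@fsbig_ordT _ L.+1); last first.
  by move=> i Li; rewrite qbinom_out ?mulr0 ?mul0r //; lia.
rewrite (fsbig_seqT ux) => [|a ax]; last first.
  rewrite big1 ?mulr0 // => -[i /= iL] _.
  by rewrite T0x ?mulr0.
under [RHS]eq_bigr do rewrite mulrCA mulr_sumr.
rewrite -mulr_sumr exchange_big /=; congr (_ * _); apply: eq_bigr => -[i /= iL] _.
rewrite hF (fsbig_seqT ux) => [|a ax]; last by rewrite T0x ?mulr0.
by rewrite mulr_sumr; apply: eq_bigr => a _; rewrite mulrCA.
Qed.

End FiniteSums.

(** * Trinomial coefficients in the inverted base and their binomial transform *)

Section TrinomialTransform.
Set Implicit Arguments.
Unset Strict Implicit.
Variables (K : fieldType) (q s : K).
Implicit Types (a k m : int) (i n r L M : nat).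
Hypothesis hs : s ^+ 2 = q.

Lemma exprz_sqrt k : q ^ k = s ^ (2 * k).
Proof. by rewrite -hs exprnP exprz_exp. Qed.

Lemma expr_bin2 i : q ^+ 'C(i, 2) = s ^ (i%:Z * (i%:Z - 1)).
Proof.
rewrite exprnP exprz_sqrt; congr (s ^ _).
by elim: i => // i IHi; rewrite binS bin1 PoszD mulrDr IHi; lia.
Qed.

Lemma exprz_binz2 a : q ^ binz2 a = s ^ (a * (a - 1)).
Proof.
rewrite exprz_sqrt; congr (s ^ _); rewrite /binz2 mulrC divzK //.
have [b [->|->]] : exists b, a = b * 2 \/ a = b * 2 + 1.
  by exists (a %/ 2)%Z; lia.
- by rewrite mulrAC dvdz_mull.
- by rewrite addrK mulrA dvdz_mull.
Qed.

Hypothesis hq0 : q != 0.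
Hypothesis hq : forall n : nat, (0 < n)%N -> q ^+ n != 1.

Lemma sqrt_neq0 : s != 0.
Proof. by apply: contraNneq hq0 => s0; rewrite -hs s0 expr0n. Qed.

(** Each factor satisfies 1 - q^(-k) = -q^(-k) (1 - q^k); writing the collected power in [s] avoids
    halving n(n+1). *)
Lemma qpochV n :
  qpoch q^-1 q^-1 n = (-1) ^ n * s ^ (- (n%:Z * (n%:Z + 1))) * qpoch q q n.
Proof.
have s0 := sqrt_neq0; elim: n => [|n IHn].
  by rewrite /qpoch !big_ord0 mul0r oppr0 !expr0z !mulr1.
have -> : s ^ (- (n.+1%:Z * (n.+1%:Z + 1)))
    = s ^ (- (n%:Z * (n%:Z + 1))) / q ^+ n.+1.
  by rewrite exprnP exprz_sqrt invr_expz -expfzDr //; congr (s ^ _); lia.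
rewrite !qpochS IHn exprSz exprVn.
have h : q ^+ n.+1 != 0 by rewrite expf_neq0.
by field.
Qed.

Lemma inv_qpochV k :
  inv_qpoch q^-1 k = (-1) ^ k * s ^ (k * (k + 1)) * inv_qpoch q k.
Proof.
case: k => n; last by rewrite /= mulr0.
by rewrite /= qpochV !invfM !invr_expz opprK -invr_expz -exprnP -exprVn invrN1.
Qed.

Lemma qtrinomTE m L a M : (L < M)%N ->
  qtrinomT s m L a = \sum_(n < M)
    s ^ ((L%:Z - 2 * n%:Z - a) * (L%:Z - 2 * n%:Z - a - m)) *
    (qpoch q q L * inv_qpoch q n%:Z * inv_qpoch q (n%:Z + a)
                 * inv_qpoch q (L%:Z - 2 * n%:Z - a)).
Proof.
move=> LM; have s0 := sqrt_neq0; rewrite /qtrinomT hs /qtrinom (@fsbig_ordT _ _ M).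
  rewrite mulr_sumr; apply: eq_bigr => n _.
  rewrite !inv_qpochV qpochV exprz_inv exprz_sqrt.
  (* The signs of the four reversals cancel, their exponents adding up to 2L. *)
  have sgn : (-1 : K) ^ L * (-1) ^ n * (-1) ^ (n%:Z + a)
             * (-1) ^ (L%:Z - 2 * n%:Z - a) = 1.
    rewrite -!expfzDr ?oppr_eq0 ?oner_eq0 //.
    have -> : L%:Z + n + (n%:Z + a) + (L%:Z - 2 * n%:Z - a) = 2 * L%:Z by ring.
    rewrite -exprz_exp (_ : (-1) ^ 2 = 1 :> K) ?exp1rz //.
    exact: etrans (sqrrN 1) (expr1n _ 2).
  rewrite -[RHS]mul1r -[X in _ = X * _]sgn.
  (* On the right, in order: the prefactor of T, the power of 1/q in the summand, and the reversals
     of the four q-factorials. *)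
  have -> : (L%:Z - 2 * n%:Z - a) * (L%:Z - 2 * n%:Z - a - m) =
    L%:Z * (L%:Z - m) - a * (a - m) + 2 * - (n%:Z * (n%:Z + (a - m)))
    - L%:Z * (L%:Z + 1) + n%:Z * (n%:Z + 1) + (n%:Z + a) * (n%:Z + a + 1)
    + (L%:Z - 2 * n%:Z - a) * (L%:Z - 2 * n%:Z - a + 1) by ring.
  by rewrite !(expfzDr _ _ s0); ring.
(* For n >= M > L the indices n + a and L - 2n - a add up to L - n < 0, so one of them is
   negative. *)
move=> n Mn; rewrite [X in _ * X](_ : _ = 0) ?mulr0 //.
case: (boolP (n%:Z + a < 0)) => [/inv_qpoch_neg -> | na].
  by rewrite mulr0 mul0r.
by rewrite [inv_qpoch _ (L%:Z - _ - _)]inv_qpoch_neg ?mulr0 //; lia.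
Qed.

(** The indices n, n + a and L - 2n - a add up to L, and a is the difference of two of them; all are
    nonnegative only if |a| <= L. *)
Lemma qtrinomT_out m L a : (L%:Z < a) || (a < - L%:Z) -> qtrinomT s m L a = 0.
Proof.
move=> La; rewrite (@qtrinomTE _ _ _ L.+1) // big1 // => -[n /= _] _.
case: (boolP (n%:Z + a < 0)) => [/inv_qpoch_neg -> | na].
  by rewrite !(mulr0, mul0r).
by rewrite [inv_qpoch _ (L%:Z - _ - _)]inv_qpoch_neg ?mulr0 //; lia.
Qed.

(** The core common to the three identities, used with m = 0, 1, -1. *)
Lemma sum_qtrinomT m a L :
  \sum_(i < L.+1) s ^ (i%:Z * (i%:Z - m)) * qbinom q L i * qtrinomT s m i a
  = s ^ (a * (a - m)) *
    \sum_(r < L.+1) q ^ (r%:Z * (r%:Z + a - m)) * qbinom q L r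
                    * qbinom q L (r%:Z + a).
Proof.
have s0 := sqrt_neq0.
(* The summand after (q;q)_i has cancelled, extended to integers x because the shift n + a may be
   negative. *)
pose F n (x : int) := s ^ (x * (x - m)) * qpoch q q L
    * s ^ ((x - 2 * n%:Z - a) * (x - 2 * n%:Z - a - m))
    * inv_qpoch q (L%:Z - x) * inv_qpoch q n%:Z
    * inv_qpoch q (n%:Z + a) * inv_qpoch q (x - 2 * n%:Z - a).
transitivity (\sum_(n < L.+1) \sum_(i < L.+1) F n i%:Z).
  rewrite exchange_big; apply: eq_bigr => -[i /= iL] _.
  rewrite (@qtrinomTE _ _ _ L.+1) // mulr_sumr; apply: eq_bigr => n _.
  rewrite qbinomE /F /=; have := qpoch_neq0 hq i.
  by move: (qpoch q q i) => u h; field; rewrite h (qpoch_neq0 hq).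
transitivity (\sum_(n < L.+1) \sum_(r < L.+1) F n (r%:Z + (n%:Z + a))).
  apply: eq_bigr => n _; apply: (@sum_ord_shift _ (F n)) => x.
  (* A nonzero term has x <= L, n + a >= 0 and x - 2n - a >= 0, which puts both x and x - (n + a) in
     [0, L]. *)
  rewrite /F !mulf_eq0 !negb_or => /andP[/andP[/andP[/andP[_ h1] _] h2] h3].
  have pos k : inv_qpoch q k != 0 -> 0 <= k by case: k => // k; rewrite eqxx.
  by move: (pos _ h1) (pos _ h2) (pos _ h3); lia.
rewrite exchange_big mulr_sumr; apply: eq_bigr => -[r /= rL] _.
(* Splitting L as r + (L - r) prepares q-Vandermonde over n for [r; n] [L-r; n+a]. *)
have -> : qbinom q L (r%:Z + a) = qbinom q (r + (L - r))%N (r%:Z + a).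
  by rewrite subnKC.
rewrite -(@q_Vandermonde _ _ hq0 hq _ _ _ L.+1) // !mulr_sumr.
apply: eq_bigr => -[n /= _] _.
rewrite /F !qbinomE (subzn (rL : (r <= L)%N)) /= !exprz_sqrt.
rewrite (_ : r%:Z + (n%:Z + a) - 2 * n%:Z - a = r%:Z - n%:Z); last by ring.
rewrite (_ : L%:Z - (r%:Z + (n%:Z + a)) = (L - r)%N%:Z - (n%:Z + a)); last by lia.
rewrite [s ^ _ * qpoch q q L]mulrC -[_ * s ^ _ * s ^ _]mulrA -expfzDr //.
rewrite (_ : _ + _ = a * (a - m) + 2 * (r%:Z * (r%:Z + a - m))
                     + 2 * (n%:Z * (n%:Z + a))); last by ring.
rewrite !expfzDr //.
by field; rewrite !(qpoch_neq0 hq).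
Qed.

End TrinomialTransform.

(** * The three transformation identities *)

Theorem theorem3p5 (K : fieldType) (q s : K)
    (hs : s ^+ 2 = q) (hq0 : q != 0)
    (hq : forall n : nat, (0 < n)%N -> q ^+ n != 1)
    (F0 F1 Fm1 : nat -> K) (alpha0 alpha1 alpham1 : int -> K)
    (hF0 : forall L : nat,
       F0 L = \sum_(a \in [set: int]) alpha0 a * qtrinomT s 0 L a)
    (hF1 : forall L : nat,
       F1 L = \sum_(a \in [set: int]) alpha1 a * qtrinomT s 1 L a)
    (hFm1 : forall L : nat,
       Fm1 L = \sum_(a \in [set: int])
                 alpham1 a * (qtrinomT s (-1) L a + qtrinomT s (-1) L (a + 1))) :
  forall L : nat,
  [/\ \sum_(i \in [set: nat]) s ^+ (i ^ 2) * qbinom q L%:Z i%:Z * F0 i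
      = \sum_(a \in [set: int])
          alpha0 a * s ^ (a ^+ 2) * qbinom q (2 * L%:Z) (L%:Z - a),
      (1 + q ^+ L) *
        \sum_(i \in [set: nat]) q ^+ 'C(i, 2) * qbinom q L%:Z i%:Z * F1 i
      = \sum_(a \in [set: int])
          alpha1 a * (1 + q ^ a) * q ^ (binz2 a)
            * qbinom q (2 * L%:Z) (L%:Z - a)
    & \sum_(i \in [set: nat]) q ^+ 'C(i.+1, 2) * qbinom q L%:Z i%:Z * Fm1 i
      = \sum_(a \in [set: int])
          alpham1 a * q ^ (binz2 (a + 1))
            * qbinom q (2 * L%:Z + 1) (L%:Z - a)].
Proof.
have s0 := sqrt_neq0 hs hq0.
have T0 m i (a : int) : (i.+1%:Z < a) || (a < - i.+1%:Z) -> qtrinomT s m i a = 0.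
  by move=> ia; rewrite (qtrinomT_out hs hq0) //; lia.
move=> L; split.
- rewrite -[LHS]mul1r (fsbig_transform _ _ _ _ (T0 0) hF0).
  apply: eq_fsbigr => a _; rewrite mul1r -mulrA; congr (_ * _).
  transitivity (\sum_(i < L.+1) s ^ (i%:Z * (i%:Z - 0)) * qbinom q L i
                  * qtrinomT s 0 i a).
    by apply: eq_bigr => i _; rewrite subr0 exprnP (_ : (i ^ 2)%N%:Z = i%:Z * i%:Z) //; lia.
  rewrite (sum_qtrinomT hs hq0 hq) subr0 -expr2; congr (_ * _).
  rewrite -(sum_q_Vandermonde_central hq0 hq).
  by apply: eq_bigr => r _; rewrite subr0.
- rewrite (fsbig_transform _ _ _ _ (T0 1) hF1).
  apply: eq_fsbigr => a _; rewrite -!mulrA; congr (_ * _).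
  transitivity ((1 + q ^+ L) * \sum_(i < L.+1) s ^ (i%:Z * (i%:Z - 1))
                  * qbinom q L i * qtrinomT s 1 i a).
    by congr (_ * _); apply: eq_bigr => i _; rewrite (expr_bin2 hs).
  rewrite (sum_qtrinomT hs hq0 hq) (exprz_binz2 hs) mulrCA.
  by rewrite (sum_q_Vandermonde_pred hq0 hq) mulrCA.
- rewrite -[LHS]mul1r (fsbig_transform _ _ _ _ _ hFm1) => [|i a ia]; last first.
    rewrite (qtrinomT_out hs hq0); last by lia.
    by rewrite (qtrinomT_out hs hq0) ?addr0 //; lia.
  apply: eq_fsbigr => a _; rewrite mul1r -mulrA; congr (_ * _).
  have expE i : q ^+ 'C(i.+1, 2) = s ^ (i%:Z * (i%:Z - (-1))).
    by rewrite (expr_bin2 hs) opprK; congr (s ^ _); lia.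
  under eq_bigr => i _ do rewrite expE mulrDr.
  rewrite big_split /= !(sum_qtrinomT hs hq0 hq) (exprz_binz2 hs).
  rewrite -(sum_q_Vandermonde_succ hq0 hq) [RHS]mulrDr.
  congr (_ + _).
    by congr (s ^ _ * _); ring.
  (* The prefactor at a + 1 is s^((a+1)(a+2)) = s^(a(a+1)) q^(a+1), which supplies the weight
     q^(a+1) of the second sum. *)
  rewrite (exprz_sqrt hs) [RHS]mulrA -expfzDr //; congr (s ^ _ * _).
  by ring.
Qed.
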